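(* Let $\mathbf a\sim\mathcal L_{\mathbf a}$ and $\mathbf b\sim\mathcal L_{\mathbf b}$ be random vectors of length $n$ with $0<\mathbb E[\mathbf a_j^2\mathbf b_j^2]<\infty$ for all $j\in[n]$, let $f:\mathbb R\to\mathbb R$ be Lipschitz with Lipschitz constant $C_f$, let $P=f(\mathbf a^T\mathbf b)$, let $M\ge1$ be an integer, and use the uniform sampling distribution $\xi^u_j=1/n$, $j\in[n]$. With $\hat P_l$, $\hat Y_l$, $\hat P$, $\mu$, $\nu$ and the complexities as defined in the context, put $$c_1=C_f(n\nu+\mu)^{1/2},\qquad c_2=2C_f^2(M+1)(n\nu+\mu)+2\mathbb V[P],\qquad c_3=1+M^{-1}.$$ Then for all $l\ge0$, $L\ge 0$, $N_l\ge1$ and $N\ge1$: (i) $|\mathbb E[\hat P_l-P]|\le c_1M^{-l/2}$; (ii) $\mathbb V[\hat Y_l]\le c_2N_l^{-1}M^{-l}$ and $\mathbb V[\hat P]\le c_2N^{-1}$; (iii) the complexity of $\hat Y_l$ satisfies $C_l\le c_3N_lM^l$ and the complexity of $\hat P$ satisfies $C(\hat P)\le c_3NM^L$.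
   Context: Notation: $[n]=\{1,\dots,n\}$. For $l\ge 0$, draw $M^l$ i.i.d. indices $r_1,\dots,r_{M^l}$ uniformly from $[n]$ (with replacement, independently of $\mathbf a,\mathbf b$), and set $$X_l(\xi^u)=\frac n{M^l}\sum_{i=1}^{M^l}\mathbf a_{r_i}\mathbf b_{r_i},\qquad \hat P_l=f(X_l(\xi^u)).$$ $\mathbb E$ and $\mathbb V$ denote expectation and variance with respect to the joint law of $\mathbf a$, $\mathbf b$ and the sampled indices. Level estimators: $\hat Y_0=\frac1{N_0}\sum_{k=1}^{N_0}\hat P_0^{(k)}$ and, for $l\ge 1$, $\hat Y_l=\frac1{N_l}\sum_{k=1}^{N_l}(\hat P_l^{(k)}-\hat P_{l-1}^{(k)})$, where the $N_l$ realisations are independent, and in the $k$-th one $\hat P_l^{(k)}$ and $\hat P_{l-1}^{(k)}$ are built from the same sample of $(\mathbf a,\mathbf b)$ and the same index sequence $(r_1,\dots,r_{M^l})$: $\hat P_l^{(k)}$ uses all $M^l$ indices and $\hat P_{l-1}^{(k)}$ uses the $M^{l-1}$ indices $r_{jM}$, $j=1,\dots,M^{l-1}$. The standard Monte Carlo estimator at level $L$ is $\hat P=\frac1N\sum_{k=1}^Nf(X_L^{(k)}(\xi^u))$ with $X_L^{(k)}(\xi^u)$ independent copies of $X_L(\xi^u)$ (fresh samples of $\mathbf a$, $\mathbf b$ and the indices). Constants: with $\xi^*_j=\sqrt{\mathbb E[\mathbf a_j^2\mathbf b_j^2]}\big/\sum_{i=1}^n\sqrt{\mathbb E[\mathbf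 a_i^2\mathbf b_i^2]}$, $$\mu=\mathbb E\Big[\sum_{i=1}^n\frac{\mathbf a_i^2\mathbf b_i^2}{\xi^*_i}-(\mathbf a^T\mathbf b)^2\Big],\qquad \nu=\sum_{i=1}^n\Big(\sqrt{\mathbb E[\mathbf a_i^2\mathbf b_i^2]}-\frac1n\sum_{j=1}^n\sqrt{\mathbb E[\mathbf a_j^2\mathbf b_j^2]}\Big)^2.$$ Complexity convention: evaluating one realisation of $X_l$ costs $M^l$ (the number of sampled indices), so $C_0=N_0$, $C_l=N_l(M^l+M^{l-1})$ for $l\ge1$, and $C(\hat P)=NM^L$. *)

(* Defs.v *)
From HB Require Import structures.
From mathcomp Require Import all_boot all_order all_algebra.
From mathcomp Require Import all_classical all_reals all_analysis.

Set Implicit Arguments.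
Unset Strict Implicit.
Unset Printing Implicit Defensive.

Import Order.TTheory GRing.Theory Num.Theory.
Import numFieldNormedType.Exports.

Local Open Scope classical_set_scope.
Local Open Scope ring_scope.

Section Independence.
Context d (T : measurableType d) (R : realType) (Pr : probability T R).

Definition independent2 (G H : set_system T) : Prop :=
  forall E F, G E -> H F -> Pr (E `&` F) = (Pr E * Pr F)%E.

Definition mutually_independent (I : finType) (G : I -> set_system T) : Prop :=
  forall (J : {set I}) (E : I -> set T), (forall i, i \in J -> G i (E i)) ->
    Pr (\bigcap_(i in [set` J]) E i) = (\prod_(i in J) Pr (E i))%E.

(* Only measurable sets are compared: a measure takes arbitrary values on the
   other ones. *)
Definition same_law d' (U : measurableType d') (X Y : T -> U) : Prop :=
  forall E, measurable E -> Pr (X @^-1` E) = Pr (Y @^-1` E).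

End Independence.

Definition sigma_of T d' (U : measurableType d') (X : T -> U) : set_system T :=
  preimage_set_system setT X measurable.

(* Every subset of the codomain is measurable; used for codomains 'I_n and
   m.-tuple 'I_n, which carry no measurable structure in the library (it would
   require them to be inhabited). *)
Definition sigma_of_discrete T U (X : T -> U) : set_system T :=
  preimage_set_system setT X discrete_measurable.

Section Estimator.
Context (R : realType) (n : nat).
Implicit Types u v : n.-tuple R.

Definition dotp u v : R := \sum_(i < n) tnth u i * tnth v i.

Definition sampled_dotp m u v (s : m.-tuple 'I_n) : R :=
  n%:R / m%:R * \sum_(i < m) tnth u (tnth s i) * tnth v (tnth s i).

Lemma coarse_index_subproof M l (M_gt0 : (0 < M)%N) (j : 'I_(M ^ l)) :
  ((j.+1 * M).-1 < M ^ l.+1)%N.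
Proof.
by rewrite prednK ?muln_gt0// expnSr leq_mul2r ltn_ord orbT.
Qed.

(* The 1-based position jM, j = 1, ..., M^l, is the 0-based (j.+1 * M).-1. *)
Definition coarse_index M l (M_gt0 : (0 < M)%N) (j : 'I_(M ^ l)) :
    'I_(M ^ l.+1) :=
  Ordinal (coarse_index_subproof M_gt0 j).

Definition coarsen M l (M_gt0 : (0 < M)%N) (s : (M ^ l.+1).-tuple 'I_n) :
    (M ^ l).-tuple 'I_n :=
  [tuple tnth s (coarse_index M_gt0 j) | j < M ^ l].

Definition level_term (f : R -> R) M (M_gt0 : (0 < M)%N) l u v :
    (M ^ l).-tuple 'I_n -> R :=
  match l with
  | 0%N => fun s => f (sampled_dotp u v s)
  | l'.+1 => fun s =>
      f (sampled_dotp u v s) - f (sampled_dotp u v (coarsen M_gt0 s))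
  end.

End Estimator.

Section Sampling.
Context d (T : measurableType d) (R : realType) (Pr : probability T R).
Context (n : nat).

Definition uniform_sample m (a b : T -> n.-tuple R)
    (r : T -> m.-tuple 'I_n) : Prop :=
  [/\ forall S, measurable (r @^-1` S),
      forall j i, Pr [set w | tnth (r w) j = i] = (n%:R^-1)%:E,
      mutually_independent Pr
        (fun j : 'I_m => sigma_of_discrete (fun w => tnth (r w) j))
    & independent2 Pr (sigma_of (fun w => (a w, b w))) (sigma_of_discrete r)].

Definition iid_realisations (a b : {RV Pr >-> n.-tuple R}) m N
    (A B : 'I_N -> {RV Pr >-> n.-tuple R})
    (r : 'I_N -> T -> m.-tuple 'I_n) : Prop :=
  [/\ forall k, same_law Pr (fun w => (A k w, B k w)) (fun w => (a w, b w)),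
      forall k, uniform_sample (A k) (B k) (r k)
    & mutually_independent Pr (fun k : 'I_N =>
        <<s sigma_of (fun w => (A k w, B k w)) `|`
            sigma_of_discrete (r k) >>)].

Definition level_estimator (f : R -> R) M (M_gt0 : (0 < M)%N) l N
    (A B : 'I_N -> T -> n.-tuple R)
    (r : 'I_N -> T -> (M ^ l).-tuple 'I_n) (w : T) : R :=
  N%:R^-1 * \sum_(k < N) level_term f M_gt0 (A k w) (B k w) (r k w).

Definition mc_estimator (f : R -> R) m N
    (A B : 'I_N -> T -> n.-tuple R)
    (r : 'I_N -> T -> m.-tuple 'I_n) (w : T) : R :=
  N%:R^-1 * \sum_(k < N) f (sampled_dotp (A k w) (B k w) (r k w)).

Definition second_moment (a b : T -> n.-tuple R) (j : 'I_n) : \bar R :=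
  'E_Pr[fun w => tnth (a w) j ^+ 2 * tnth (b w) j ^+ 2].

Definition root_moment (a b : T -> n.-tuple R) (j : 'I_n) : R :=
  Num.sqrt (fine (second_moment a b j)).

Definition xi_star (a b : T -> n.-tuple R) (j : 'I_n) : R :=
  root_moment a b j / \sum_(i < n) root_moment a b i.

Definition mu (a b : T -> n.-tuple R) : R :=
  fine 'E_Pr[fun w =>
    \sum_(i < n) tnth (a w) i ^+ 2 * tnth (b w) i ^+ 2 / xi_star a b i
    - dotp (a w) (b w) ^+ 2].

Definition nu (a b : T -> n.-tuple R) : R :=
  \sum_(i < n) (root_moment a b i
                - n%:R^-1 * \sum_(j < n) root_moment a b j) ^+ 2.

End Sampling.

Definition level_cost (M N l : nat) : nat :=
  if l is l'.+1 then (N * (M ^ l + M ^ l'))%N else N.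

Definition mc_cost (M N L : nat) : nat := (N * M ^ L)%N.

(* Main.v *)
Require Import Defs.
From HB Require Import structures.
From mathcomp Require Import all_boot all_order all_algebra.
From mathcomp Require Import all_classical all_reals all_analysis.
From mathcomp Require Import measurable_realfun ring lra.

Set Implicit Arguments.
Unset Strict Implicit.
Unset Printing Implicit Defensive.

Import Order.TTheory GRing.Theory Num.Theory.
Import numFieldNormedType.Exports.

Local Open Scope classical_set_scope.
Local Open Scope ring_scope.

(** Write [z_i = a_i b_i] and [x = \sum_i z_i].  Conditionally on the vectors,
    an average over [p] distinct positions of the index sequence is the mean of
    [p] uniform i.i.d. copies of [n z_i], so its mean square distance to [x] is
    [(n \sum_i z_i^2 - x^2) / p]; the expectation of the numerator is exactly
    [n nu + mu].  With the Lipschitz bound this gives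
    [E (P_g - P)^2 <= Cf^2 (n nu + mu) / p] for every such average [g].  (i) is
    then [(E Z)^2 <= E Z^2], and the variance of one level term follows from
    [(u - w)^2 <= 2 (u - v)^2 + 2 (v - w)^2] with [v = P], both the fine and the
    coarse averages being of the above form.  Independent realisations are
    uncorrelated, which yields the factor [1 / N]. *)

(** * Image measures, and independence as a product law *)

Section Law.
Context d (T : measurableType d) (R : realType) (P : probability T R).

(** Both sides integrate [h] against image measures; these agree on measurable sets, which is all an
    integral sees. *)
Lemma same_law_ge0_integral d' (U : measurableType d') (X Y : T -> U)
    (h : U -> \bar R) :
  measurable_fun setT X -> measurable_fun setT Y -> same_law P X Y ->
  measurable_fun setT h -> (forall u, 0 <= h u)%E ->
  (\int[P]_w h (X w) = \int[P]_w h (Y w))%E.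
Proof.
move=> mX mY XY mh h0.
pose X' : {RV P >-> U} := mfun_Sub (mem_set mX).
pose Y' : {RV P >-> U} := mfun_Sub (mem_set mY).
rewrite -[LHS](ge0_integral_distribution X' mh h0).
rewrite -[RHS](ge0_integral_distribution Y' mh h0).
by apply: eq_measure_integral => E mE _; exact: XY.
Qed.

Section Product.
Context d1 d2 (U : measurableType d1) (V : measurableType d2).
Variables (X : T -> U) (Y : T -> V).
Hypotheses (mX : measurable_fun setT X) (mY : measurable_fun setT Y).
Hypothesis XY : independent2 P (sigma_of X) (sigma_of Y).

Let mXY : measurable_fun setT (fun w => (X w, Y w)).
Proof. exact: measurable_fun_pair. Qed.

Let X' : {RV P >-> U} := mfun_Sub (mem_set mX).
Let Y' : {RV P >-> V} := mfun_Sub (mem_set mY).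
Let XY' : {RV P >-> (U * V)%type} := mfun_Sub (mem_set mXY).

(** Independence is the factorisation on measurable rectangles, and rectangles determine the product
    measure. *)
Lemma independent2_distribution E : measurable E ->
  distribution P XY' E = (distribution P X' \x distribution P Y')%E E.
Proof.
move=> mE; apply/esym/product_measure_unique => // A B mA mB.
have := XY (E := X @^-1` A) (F := Y @^-1` B).
by apply; [exists A|exists B] => //; rewrite setTI.
Qed.

(** The joint law is a product, so Tonelli splits the integral; by nonnegativity, infinite values
    are allowed. *)
Lemma independent2_ge0_integralM (f : U -> \bar R) (g : V -> \bar R) :
  measurable_fun setT f -> measurable_fun setT g ->
  (forall u, 0 <= f u)%E -> (forall v, 0 <= g v)%E ->
  (\int[P]_w (f (X w) * g (Y w)) = \int[P]_w f (X w) * \int[P]_w g (Y w))%E.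
Proof.
move=> mf mg f0 g0.
pose h (z : U * V) := (f z.1 * g z.2)%E.
have mh : measurable_fun setT h.
  by apply: emeasurable_funM; exact: measurableT_comp.
have h0 z : (0 <= h z)%E by rewrite mule_ge0.
rewrite -[LHS](ge0_integral_distribution XY' mh h0).
rewrite (eq_measure_integral _ (fun E mE _ => independent2_distribution mE)).
rewrite fubini_tonelli1// /fubini_F.
rewrite -(ge0_integral_distribution X' mf f0).
rewrite -(ge0_integral_distribution Y' mg g0).
rewrite -ge0_integralZr ?integral_ge0//=.
by apply: eq_integral => u _; rewrite /h/= ge0_integralZl.
Qed.

End Product.
End Law.

(** * Square-integrable variables: variance, covariance and means *)

Section SquareIntegrable.
Context d (T : measurableType d) (R : realType) (P : probability T R).
Implicit Types X Y Z : T -> R.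

Lemma Lfun2_lty X : measurable_fun setT X ->
  (\int[P]_w (X w ^+ 2)%:E < +oo)%E -> X \in Lfun P 2%:E.
Proof.
move=> mX X2; rewrite inE; apply/andP; split; rewrite inE//=.
rewrite /finite_norm unlock poweR_lty//; apply: le_lt_trans X2.
rewrite le_eqVlt; apply/orP; left; apply/eqP; apply: eq_integral => w _ /=.
by rewrite powR_mulrn// real_normK ?num_real.
Qed.

Lemma Lfun2_measurable X : X \in Lfun P 2%:E -> measurable_fun setT X.
Proof. by move=> /sub_Lfun_mfun; rewrite inE. Qed.

Lemma Lfun2B X Y : X \in Lfun P 2%:E -> Y \in Lfun P 2%:E ->
  X \- Y \in Lfun P 2%:E.
Proof. by move=> X2 Y2; rewrite rpredB ?lee1n. Qed.

Lemma Lfun2_expectation_sqr_fin_num X : X \in Lfun P 2%:E ->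
  ('E_P[X ^+ 2])%E \is a fin_num.
Proof.
by move=> X2; rewrite expectation_fin_num//; exact: Lfun2_mul_Lfun1.
Qed.

Lemma Lfun2_expectation_fin_num X : X \in Lfun P 2%:E ->
  ('E_P[X])%E \is a fin_num.
Proof.
by move=> X2; rewrite expectation_fin_num// Lfun_subset12// fin_num_measure.
Qed.

Lemma sqr_expectation_le X : X \in Lfun P 2%:E ->
  ('E_P[X] ^+ 2 <= 'E_P[X ^+ 2])%E.
Proof.
move=> X2; have := variance_ge0 P X.
by rewrite varianceE// sube_ge0// fin_numX// Lfun2_expectation_fin_num.
Qed.

(** Shifting by [c] keeps the variance, and [V[X - c]] is [E (X - c)^2] minus the square of a
    mean. *)
Lemma variance_le_sqr X c : X \in Lfun P 2%:E ->
  ('V_P[X] <= 'E_P[fun w => ((X w - c) ^+ 2)%R])%E.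
Proof.
move=> X2; rewrite -(varianceB_cst_r c X2).
have Xc2 := Lfun2B X2 (Lfun_cst P c 2).
rewrite varianceE// (_ : (fun _ => _) = (X \- cst c) ^+ 2)//.
by rewrite leeBlDr ?fin_numX ?Lfun2_expectation_fin_num// leeDl// sqre_ge0.
Qed.

(** Fubini under the product law gives [E XY = E X E Y]; the variables are signed, so integrability
    is carried along. *)
Lemma independent2_covariance0 X Y :
  X \in Lfun P 2%:E -> Y \in Lfun P 2%:E ->
  independent2 P (sigma_of X) (sigma_of Y) -> covariance P X Y = 0%E.
Proof.
move=> X2 Y2 XY.
have Pfin : P setT \is a fin_num := fin_num_measure P _ measurableT.
have X1 := Lfun_subset12 Pfin X2; have Y1 := Lfun_subset12 Pfin Y2.
have XY1 := Lfun2_mul_Lfun1 X2 Y2.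
have mX := Lfun2_measurable X2; have mY := Lfun2_measurable Y2.
pose X' : {RV P >-> R} := mfun_Sub (mem_set mX).
pose Y' : {RV P >-> R} := mfun_Sub (mem_set mY).
pose h (z : R * R) := (z.1 * z.2)%:E.
have mh : measurable_fun setT h.
  by apply/measurable_EFinP; apply: measurable_funM.
have iXY : P.-integrable setT (h \o (fun w => (X w, Y w))).
  exact/Lfun1_integrable.
have mXY : measurable_fun setT (fun w => (X w, Y w)).
  exact: measurable_fun_pair.
pose XY' : {RV P >-> (R * R)%type} := mfun_Sub (mem_set mXY).
have law := independent2_distribution mX mY XY.
rewrite covarianceE//.
suff -> : 'E_P[X * Y]%E = ('E_P[X] * 'E_P[Y])%E.
  by rewrite subee// fin_numM ?expectation_fin_num.
rewrite unlock -[LHS](integral_distribution (X := XY') mh iXY).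
(* The product law is the joint law, so integrability of [X * Y] transfers to it along the
   pushforward. *)
have ih : (distribution P X' \x distribution P Y')%E.-integrable setT h.
  have /integrableP[_ hoo] := integrable_pushforward mXY mh iXY measurableT.
  apply/integrableP; split => //; apply: le_lt_trans hoo.
  rewrite le_eqVlt; apply/orP; left; apply/eqP/eq_measure_integral => E mE _.
  exact/esym/law.
rewrite (eq_measure_integral _ (fun E mE _ => law E mE)).
rewrite -integral12_prod_meas1//.
have mid : measurable_fun setT (EFin : R -> \bar R) by exact/measurable_EFinP.
have iX : P.-integrable setT (EFin \o X') by exact/Lfun1_integrable.
have iY : P.-integrable setT (EFin \o Y') by exact/Lfun1_integrable.
rewrite -[X in (X * _)%E](integral_distribution (X := X') mid iX).
rewrite -[X in (_ * X)%E](integral_distribution (X := Y') mid iY).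
have eY : (\int[distribution P Y']_y y%:E)%E \is a fin_num.
  rewrite (integral_distribution (X := Y') mid iY).
  exact: integrable_fin_num.
rewrite -(fineK eY) -integralZr//; last first.
  exact: (integrable_pushforward (phi := X') mX mid iX measurableT).
apply: eq_integral => x _; rewrite /fubini_F /h/= fineK//.
under eq_integral do rewrite EFinM.
rewrite integralZl//.
exact: (integrable_pushforward (phi := Y') mY mid iY measurableT).
Qed.

(** Induction on the list: by bilinearity each new term is uncorrelated with the sum of the others,
    its index being distinct from theirs by [uniq]. *)
Lemma variance_sum (I : eqType) (s : seq I) (X : I -> T -> R) :
  (forall i, X i \in Lfun P 2%:E) ->
  (forall i j, i != j -> covariance P (X i) (X j) = 0%E) ->
  uniq s -> ('V_P[(\sum_(i <- s) X i)%R] = \sum_(i <- s) 'V_P[X i])%E.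
Proof.
move=> X2 cov0.
have S2 t : \sum_(i <- t) X i \in Lfun P 2%:E.
  by rewrite rpred_sum ?lee1n//= => i _; exact: X2.
have covS i t : i \notin t -> covariance P (X i) (\sum_(j <- t) X j) = 0%E.
  elim: t => [|j t IH]; first by rewrite big_nil covariance_cst_r.
  rewrite inE negb_or big_cons => /andP[ij it].
  by rewrite covarianceDr// cov0// IH// adde0.
elim: s => [_|i s IH /=]; first by rewrite !big_nil variance_cst.
move=> /andP[is_ us]; rewrite !big_cons varianceD// IH// covS//.
by rewrite mule0 adde0.
Qed.

(** Scaling contributes [N^-2], and the uncorrelated sum has variance at most [N v]. *)
Lemma variance_mean_le N (X : 'I_N -> T -> R) (v : \bar R) : (0 < N)%N ->
  (forall k, X k \in Lfun P 2%:E) ->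
  (forall k l, k != l -> covariance P (X k) (X l) = 0%E) ->
  (forall k, ('V_P[X k] <= v)%E) ->
  ('V_P[fun w => (N%:R^-1 * \sum_(k < N) X k w)%R] <= N%:R^-1%:E * v)%E.
Proof.
move=> N0 X2 cov0 Xv.
have S2 : \sum_(k < N) X k \in Lfun P 2%:E.
  by rewrite rpred_sum ?lee1n//= => i _; exact: X2.
rewrite (_ : (fun _ => _) = N%:R^-1 \o* (\sum_(k < N) X k)); last first.
  by apply/funext => w /=; rewrite mulrC fct_sumE.
rewrite varianceZ// variance_sum ?index_enum_uniq// expr2 EFinM -muleA.
rewrite lee_pmul2l ?lte_fin ?invr_gt0 ?ltr0n//.
rewrite muleC lee_pdivrMr ?ltr0n//.
apply: le_trans (lee_sum _ (fun k _ => Xv k)) _.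
by rewrite sumr_const card_ord muleC mule_natl.
Qed.

End SquareIntegrable.

(** * Averages over uniform index tuples *)

Lemma sum_tuple_prod (R : comNzRingType) (J : finType) m (F : 'I_m -> J -> R) :
  \sum_(s : m.-tuple J) \prod_(k < m) F k (tnth s k) =
  \prod_(k < m) \sum_j F k j.
Proof.
(* Distributivity expands the product into a sum over finite functions, which correspond bijectively
   to tuples. *)
rewrite bigA_distr_bigA/=.
rewrite (reindex (fun s : {ffun 'I_m -> J} => [tuple s k | k < m])) /=.
  by apply: eq_bigr => s _; apply: eq_bigr => k _; rewrite tnth_mktuple.
exists (fun s : m.-tuple J => [ffun k => tnth s k]) => s _.
  by apply/ffunP => k; rewrite ffunE tnth_mktuple.
by apply: eq_from_tnth => k; rewrite tnth_mktuple ffunE.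
Qed.

Section UniformTuples.
Context (R : numFieldType) (n m : nat).
Implicit Types (y z : 'I_n -> R).

(** Under the uniform weight [n^-m] the coordinates are independent and [y] has mean zero, so
    distinct positions are uncorrelated. *)
Lemma uniform_mean_mul y i i' : (0 < n)%N -> \sum_j y j = 0 ->
  \sum_(s : m.-tuple 'I_n) n%:R^-1 ^+ m * (y (tnth s i) * y (tnth s i')) =
  if i == i' then n%:R^-1 * \sum_j y j ^+ 2 else 0.
Proof.
move=> n0 y0; have nn0 : n%:R != 0 :> R by rewrite pnatr_eq0 -lt0n.
(* [F k] gathers all that depends on coordinate [k], including its weight [n^-1], so the sum over
   tuples becomes a product of one-coordinate sums. *)
pose F k j := n%:R^-1 * ((if k == i then y j else 1) *
                         (if k == i' then y j else 1)).
have FE (s : m.-tuple 'I_n) : \prod_(k < m) F k (tnth s k) =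
    n%:R^-1 ^+ m * (y (tnth s i) * y (tnth s i')).
  rewrite !big_split/= prodr_const card_ord.
  by congr (_ * (_ * _)); rewrite -big_mkcond big_pred1_eq.
under eq_bigr do rewrite -FE.
rewrite sum_tuple_prod (bigD1 i)//= /F eqxx; case: eqVneq => [<-|_].
  rewrite [X in _ * X]big1 ?mulr1 -?mulr_sumr// => k ki.
  by rewrite (negPf ki) !mulr1 sumr_const card_ord -[_ *+ n]mulr_natr mulVf.
by under eq_bigr do rewrite mulr1; rewrite -mulr_sumr y0 mulr0 mul0r.
Qed.

(** Centring [n z_j] at its mean [x] gives [y]. In the expanded square only the diagonal survives,
    [g] being injective: [p] equal terms against the factor [p^-2]. *)
Lemma uniform_mean_sqr_dev p (g : 'I_p -> 'I_m) z :
  injective g -> (0 < p)%N ->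
  \sum_(s : m.-tuple 'I_n) n%:R^-1 ^+ m *
    (n%:R / p%:R * \sum_(k < p) z (tnth s (g k)) - \sum_j z j) ^+ 2 =
  p%:R^-1 * (n%:R * \sum_j z j ^+ 2 - (\sum_j z j) ^+ 2).
Proof.
move=> ginj p0; set x := \sum_j z j.
have pp0 : p%:R != 0 :> R by rewrite pnatr_eq0 -lt0n.
(* For [n = 0] the weight [n^-1] is the default 0 and cannot be cancelled. Both sides vanish: an
   [m]-tuple would yield an element of ['I_0] at the position [g (Ordinal p0)]. *)
have [n0|n_gt0] := posnP n.
  have no_ord (P : Prop) (j : 'I_n) : P.
    by have := leq_ltn_trans (leq0n j) (ltn_ord j); rewrite n0.
  have zE (h : 'I_n -> R) : \sum_j h j = 0 by apply: big1 => j; exact: no_ord.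
  rewrite /x !zE expr0n subr0 mulr0 mulr0 big1// => s _.
  exact: no_ord (tnth s (g (Ordinal p0))).
have nn0 : n%:R != 0 :> R by rewrite pnatr_eq0 -lt0n.
pose y j := n%:R * z j - x.
have y0 : \sum_j y j = 0.
  by rewrite sumrB -mulr_sumr sumr_const card_ord mulr_natl subrr.
have sumy2 : \sum_j y j ^+ 2 = n%:R * (n%:R * \sum_j z j ^+ 2 - x ^+ 2).
  transitivity (\sum_j (n%:R ^+ 2 * z j ^+ 2 - 2 * n%:R * x * z j + x ^+ 2)).
    by apply: eq_bigr => j _; rewrite /y; ring.
  rewrite big_split sumrB/= -!mulr_sumr sumr_const card_ord -/x.
  by rewrite -(mulr_natl x); ring.
have devE (s : m.-tuple 'I_n) :
    n%:R / p%:R * \sum_(k < p) z (tnth s (g k)) - x =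
    p%:R^-1 * \sum_(k < p) y (tnth s (g k)).
  rewrite sumrB sumr_const card_ord -mulr_sumr -(mulr_natl x).
  by field.
have sqrE (s : m.-tuple 'I_n) :
    n%:R^-1 ^+ m * (n%:R / p%:R * \sum_(k < p) z (tnth s (g k)) - x) ^+ 2 =
    p%:R^-1 ^+ 2 * \sum_(k < p) \sum_(k' < p)
      n%:R^-1 ^+ m * (y (tnth s (g k)) * y (tnth s (g k'))).
  rewrite devE exprMn mulrCA; congr (_ * _).
  rewrite expr2 mulr_suml mulr_sumr; apply: eq_bigr => k _.
  by rewrite mulr_sumr mulr_sumr.
under eq_bigr do rewrite sqrE.
rewrite -mulr_sumr exchange_big/=.
under eq_bigr => k _.
  rewrite exchange_big/=.
  under eq_bigr do rewrite uniform_mean_mul// (inj_eq ginj).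
  rewrite -big_mkcond (big_pred1 k) => [|k']; last by rewrite eq_sym.
  over.
rewrite sumr_const card_ord -[_ *+ p]mulr_natl sumy2.
by field; rewrite pp0 nn0.
Qed.

End UniformTuples.

(** * The sampling variance for fixed vectors, and measurability in the vectors *)

Section TuplePair.
Context (R : realType) (n : nat).
Local Notation vectors := (n.-tuple R * n.-tuple R)%type.

(* The variance of [n * u_i * v_i] for a uniform index [i]. *)
Definition sampling_variance (u v : n.-tuple R) : R :=
  n%:R * (\sum_(i < n) (tnth u i * tnth v i) ^+ 2) - dotp u v ^+ 2.

(** It is the mean square deviation of a single draw, the case [m = p = 1]. *)
Lemma sampling_variance_ge0 u v : 0 <= sampling_variance u v.
Proof.
have := @uniform_mean_sqr_dev R n 1 1 id (fun i => tnth u i * tnth v i).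
rewrite invr1 mul1r /sampling_variance /dotp => <- //.
apply: sumr_ge0 => s _.
by rewrite mulr_ge0 ?sqr_ge0// exprn_ge0// invr_ge0 ler0n.
Qed.

Lemma measurable_coordM i :
  measurable_fun setT (fun uv : vectors => tnth uv.1 i * tnth uv.2 i).
Proof.
have mtnth := @measurable_tnth _ R n i.
by apply: measurable_funM; exact: (measurableT_comp mtnth).
Qed.

Lemma measurable_dotp :
  measurable_fun setT (fun uv : vectors => dotp uv.1 uv.2).
Proof. by apply: measurable_sum => i; exact: measurable_coordM. Qed.

Lemma measurable_sampled_dotp m (s : m.-tuple 'I_n) :
  measurable_fun setT (fun uv : vectors => sampled_dotp uv.1 uv.2 s).
Proof.
apply: measurable_funM => //; apply: measurable_sum => i.
exact: measurable_coordM.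
Qed.

Lemma measurable_sampling_variance :
  measurable_fun setT (fun uv : vectors => sampling_variance uv.1 uv.2).
Proof.
apply: measurable_funB; last by apply: measurable_funX; exact: measurable_dotp.
apply: measurable_funM => //; apply: measurable_sum => i.
by apply: measurable_funX; exact: measurable_coordM.
Qed.

End TuplePair.

(** * Integrating out the sampled indices *)

Section UniformSample.
Context d (T : measurableType d) (R : realType) (P : probability T R) (n : nat).
Variables (A B : T -> n.-tuple R).
Hypotheses (mA : measurable_fun setT A) (mB : measurable_fun setT B).
Variables (m : nat) (r : T -> m.-tuple 'I_n).
Hypothesis rU : uniform_sample P A B r.

Lemma uniform_sample_law s : P (r @^-1` [set s]) = (n%:R^-1 ^+ m)%:E.
Proof.
have [_ unif indep _] := rU.
have := indep [set: 'I_m]%SET (fun i => [set w | tnth (r w) i = tnth s i]).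
rewrite (_ : \bigcap_(i in _) _ = r @^-1` [set s]); last first.
  apply/seteqP; split => [w /= rs|w /= rs i _ /=]; last by rewrite rs.
  by apply: eq_from_tnth => i; apply: rs; rewrite /= inE.
move=> ->; last first.
  move=> i _; exists [set tnth s i] => //.
  by rewrite setTI.
under eq_bigr do rewrite unif.
by rewrite prodEFin prodr_const cardsT card_ord.
Qed.

(** Conditioning on the index sequence: each event [r w = s] is independent of the vectors and has
    probability [n^-m]. *)
Lemma uniform_sample_ge0_integral
    (h : n.-tuple R * n.-tuple R -> m.-tuple 'I_n -> \bar R) :
  (forall s, measurable_fun setT (h ^~ s)) -> (forall u s, 0 <= h u s)%E ->
  (\int[P]_w h (A w, B w) (r w) =
   \sum_(s : m.-tuple 'I_n)
     (n%:R^-1 ^+ m)%:E * \int[P]_w h (A w, B w) s)%E.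
Proof.
move=> mh h0; have [mr _ _ indep] := rU.
have mAB : measurable_fun setT (fun w => (A w, B w)).
  exact: measurable_fun_pair.
(* The event enters as a boolean variable, whose sigma-algebra is contained in that of [r]. *)
pose ind s w := (r w == s).
have mind s : measurable_fun setT (ind s).
  move=> _ C _; rewrite setTI.
  by have := mr [set t | C (t == s)].
pose g (b : bool) := (b%:R : R)%:E.
have mg : measurable_fun setT g by [].
have g0 b : (0 <= g b)%E by rewrite lee_fin ler0n.
have hE w : (h (A w, B w) (r w) =
    \sum_(s : m.-tuple 'I_n) h (A w, B w) s * g (ind s w))%E.
  rewrite (bigD1 (r w))//= /ind eqxx mule1 big1 ?adde0// => s srw.
  by rewrite eq_sym (negPf srw) mule0.
under eq_integral do rewrite hE.
rewrite ge0_integral_sum//; last 2 first.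
- move=> s; apply: emeasurable_funM; first exact: (measurableT_comp (mh s)).
  exact: (measurableT_comp mg).
- by move=> s w _; rewrite mule_ge0.
apply: eq_bigr => s _.
have indep_s : independent2 P (sigma_of (fun w => (A w, B w)))
    (sigma_of (ind s)).
  move=> E F sE [C _ <-]; apply: indep => //.
  by exists [set t | C (t == s)].
rewrite (_ : integral _ _ _ =
    \int[P]_w h (A w, B w) s * \int[P]_w g (ind s w))%E; last first.
  exact: (independent2_ge0_integralM mAB (mind s) indep_s (mh s) mg).
rewrite muleC; congr (_ * _)%E; rewrite -(uniform_sample_law s).
rewrite -(setIT (r @^-1` _)) -integral_indic//.
apply: eq_integral => w _; rewrite indicE /g /ind.
by congr ((nat_of_bool _)%:R%:E); apply/eqP/idP; rewrite inE.
Qed.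

(** Exchanging the weighted sum over [s] with the integral leaves, for fixed vectors, the identity
    [uniform_mean_sqr_dev]. *)
Lemma uniform_sample_sqr_dev p (g : 'I_p -> 'I_m) :
  injective g -> (0 < p)%N ->
  (\int[P]_w ((sampled_dotp (A w) (B w) [tuple tnth (r w) (g k) | k < p]
              - dotp (A w) (B w)) ^+ 2)%:E =
   p%:R^-1%:E * \int[P]_w (sampling_variance (A w) (B w))%:E)%E.
Proof.
move=> ginj p0.
pose D u v (s : m.-tuple 'I_n) : R :=
  (sampled_dotp u v [tuple tnth s (g k) | k < p] - dotp u v) ^+ 2.
have DE u v : \sum_(s : m.-tuple 'I_n) n%:R^-1 ^+ m * D u v s =
    p%:R^-1 * sampling_variance u v.
  rewrite -(uniform_mean_sqr_dev _ ginj)//; apply: eq_bigr => s _.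
  congr (_ * (_ * _ - _) ^+ 2); apply: eq_bigr => k _.
  by rewrite tnth_mktuple.
pose h (uv : n.-tuple R * n.-tuple R) s := (D uv.1 uv.2 s)%:E.
have mh s : measurable_fun setT (h ^~ s).
  have mD : measurable_fun setT
      (fun uv : n.-tuple R * n.-tuple R => D uv.1 uv.2 s).
    apply: measurable_funX; apply: measurable_funB.
      exact: measurable_sampled_dotp.
    exact: measurable_dotp.
  by move/measurable_EFinP: mD.
have h0 u s : (0 <= h u s)%E by rewrite lee_fin sqr_ge0.
have mAB : measurable_fun setT (fun w => (A w, B w)).
  exact: measurable_fun_pair.
have mhAB s : measurable_fun setT (fun w => h (A w, B w) s).
  exact: (measurableT_comp (mh s)).
rewrite (uniform_sample_ge0_integral mh h0).
have w0 : (0 <= (n%:R^-1 ^+ m)%:E :> \bar R)%E.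
  by rewrite lee_fin exprn_ge0// invr_ge0 ler0n.
under eq_bigr do rewrite -ge0_integralZl//.
rewrite -ge0_integral_sum//; last 2 first.
- by move=> s; apply: measurable_funeM.
- by move=> s w _; rewrite mule_ge0.
have mV : measurable_fun setT (fun w => (sampling_variance (A w) (B w))%:E).
  have := measurableT_comp (@measurable_sampling_variance R n) mAB.
  by move/measurable_EFinP.
rewrite -[RHS]ge0_integralZl ?lee_fin ?invr_ge0 ?ler0n//; last first.
  by move=> w _; rewrite lee_fin sampling_variance_ge0.
by apply: eq_integral => w _; rewrite -EFinM -DE -sumEFin.
Qed.

End UniformSample.

(** * Moments of the coordinate products and the value of [n nu + mu] *)

Section Moments.
Context d (T : measurableType d) (R : realType) (P : probability T R) (n : nat).
Variables (a b : {RV P >-> n.-tuple R}).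
Hypothesis moment_ab : forall j : 'I_n, (0 < second_moment P a b j < +oo)%E.

Local Notation q := (root_moment P a b).
Local Notation z i w := (tnth (a w) i * tnth (b w) i).

Lemma root_moment_sqr j : ((q j ^+ 2)%:E = second_moment P a b j)%E.
Proof.
have /andP[m0 moo] := moment_ab j.
by rewrite sqr_sqrtr ?fine_ge0 ?ltW// fineK// ge0_fin_numE// ltW.
Qed.

Lemma root_moment_gt0 j : 0 < q j.
Proof. by rewrite sqrtr_gt0 fine_gt0. Qed.

Lemma measurable_pair_ab : measurable_fun setT (fun w => (a w, b w)).
Proof. exact: measurable_fun_pair. Qed.

Lemma integral_coordM_sqr j : (\int[P]_w (z j w ^+ 2)%:E = (q j ^+ 2)%:E)%E.
Proof.
rewrite root_moment_sqr /second_moment unlock.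
by apply: eq_integral => w _; rewrite exprMn.
Qed.

Lemma Lfun2_coordM j : (fun w => z j w) \in Lfun P 2%:E.
Proof.
apply: Lfun2_lty; last by rewrite integral_coordM_sqr ltry.
exact: (measurableT_comp (@measurable_coordM R n j) measurable_pair_ab).
Qed.

Lemma Lfun2_dotp : (fun w => dotp (a w) (b w)) \in Lfun P 2%:E.
Proof.
have -> : (fun w => dotp (a w) (b w)) = \sum_(j < n) (fun w => z j w).
  by apply/funext => w; rewrite fct_sumE.
by rewrite rpred_sum ?lee1n//= => _ j _; exact: Lfun2_coordM.
Qed.

(** The coefficients stay general for two uses: [c_i = n] gives the sampling variance, the inverse
    of [xi_star] gives [mu]. *)
Lemma expectation_sum_sqr_sub (c : 'I_n -> R) :
  ('E_P[fun w => (\sum_(i < n) c i * z i w ^+ 2 - dotp (a w) (b w) ^+ 2)%R] =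
   (\sum_(i < n) c i * q i ^+ 2)%:E
   - 'E_P[fun w => (dotp (a w) (b w) ^+ 2)%R])%E.
Proof.
have iz i : P.-integrable setT (fun w => (c i)%:E * (z i w ^+ 2)%:E)%E.
  by apply: integrableZl => //; exact: Lfun2_integrable_sqr (Lfun2_coordM i).
have isum : P.-integrable setT
    (EFin \o (fun w => \sum_(i < n) c i * z i w ^+ 2)).
  rewrite (_ : _ \o _ =
      (fun w => \sum_(i < n) ((c i)%:E * (z i w ^+ 2)%:E))%E); last first.
    by apply/funext => w /=; rewrite -sumEFin.
  exact: integrable_sum.
rewrite unlock.
rewrite (integralB_EFin _ isum (Lfun2_integrable_sqr Lfun2_dotp))//.
congr (_ - _)%E.
transitivity (\int[P]_w \sum_(i < n) ((c i)%:E * (z i w ^+ 2)%:E))%E.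
  by apply: eq_integral => w _; rewrite -sumEFin.
rewrite integral_sum// -sumEFin; apply: eq_bigr => i _.
rewrite integralZl//; last exact: Lfun2_integrable_sqr (Lfun2_coordM i).
by rewrite integral_coordM_sqr.
Qed.

(* With [S] the sum of the [q_i], [mu = S ^ 2 - E (a.b) ^ 2] and
   [n * nu = n * (\sum_i q_i ^ 2) - S ^ 2]. *)
Lemma integral_sampling_variance :
  (\int[P]_w (sampling_variance (a w) (b w))%:E =
   (n%:R * nu P a b + mu P a b)%:E)%E.
Proof.
have Dfin := Lfun2_expectation_sqr_fin_num Lfun2_dotp.
have -> : (\int[P]_w (sampling_variance (a w) (b w))%:E =
    (n%:R * \sum_(i < n) q i ^+ 2)%:E
    - 'E_P[fun w => (dotp (a w) (b w) ^+ 2)%R])%E.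
  rewrite mulr_sumr -(expectation_sum_sqr_sub (fun=> n%:R)) unlock.
  by apply: eq_integral => w _; rewrite /sampling_variance mulr_sumr.
set S := \sum_(i < n) q i.
have muE : mu P a b =
    S ^+ 2 - fine 'E_P[fun w => (dotp (a w) (b w) ^+ 2)%R]%E.
  rewrite -[LHS]/(fine _) (_ : 'E_P[_]%E =
     ((S ^+ 2)%:E - 'E_P[fun w => (dotp (a w) (b w) ^+ 2)%R])%E).
    by rewrite fineB.
  (* As [q_i > 0], dividing [q_i^2] by [xi_star] gives [S q_i], and these sum to [S^2]. *)
  have -> : S ^+ 2 = \sum_(i < n) (xi_star P a b i)^-1 * q i ^+ 2.
    rewrite expr2 {1}/S mulr_suml; apply: eq_bigr => i _.
    rewrite /xi_star -/S invf_div expr2 mulrA divfK ?gt_eqF ?root_moment_gt0//.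
    exact: mulrC.
  rewrite -expectation_sum_sqr_sub; congr expectation; apply/funext => w.
  by congr (_ - _); apply: eq_bigr => i _; rewrite exprMn mulrC.
have nuE : n%:R * nu P a b = n%:R * \sum_(i < n) q i ^+ 2 - S ^+ 2.
  (* Expanding the square uses [n * n^-1 = 1]; for [n = 0] all sums are empty. *)
  have [n0|n_gt0] := posnP n.
    have -> : S = 0.
      rewrite /S big1// => i _; exfalso.
      by have := leq_ltn_trans (leq0n i) (ltn_ord i); rewrite n0.
    by rewrite (_ : n%:R = 0) ?n0// !mul0r expr0n subrr.
  have nn0 : n%:R != 0 :> R by rewrite pnatr_eq0 -lt0n.
  have -> : nu P a b =
      \sum_(i < n) (q i ^+ 2 - 2 * n%:R^-1 * S * q i + (n%:R^-1 * S) ^+ 2).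
    by apply: eq_bigr => i _; rewrite -/S; ring.
  rewrite big_split sumrB/= -mulr_sumr -/S sumr_const card_ord.
  by rewrite -[_ *+ n]mulr_natl; field.
by rewrite nuE muE addrA subrK EFinB fineK.
Qed.

End Moments.

(** * The sigma-algebra of one realisation, and pairwise independence *)

Section JointSigmaAlgebra.
Context d (T : measurableType d) (R : realType) (P : probability T R).
Context (n m : nat).
Variables (A B : {RV P >-> n.-tuple R}) (r : T -> m.-tuple 'I_n).
Local Notation G := (sigma_of (fun w => (A w, B w)) `|` sigma_of_discrete r).
Variable F : n.-tuple R * n.-tuple R -> m.-tuple 'I_n -> R.
Hypothesis mF : forall s, measurable_fun setT (F ^~ s).

(** The preimage is a finite union over [s] of intersections of two generators. Membership in this
    sigma-algebra, sharper than measurability, is what the independence of realisations applies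
    to. *)
Lemma joint_sigma_algebra_preimage E : measurable E ->
  <<s G >> ((fun w => F (A w, B w) (r w)) @^-1` E).
Proof.
move=> mE.
pose S s := ((fun w => F (A w, B w) s) @^-1` E) `&` (r @^-1` [set s]).
have -> : (fun w => F (A w, B w) (r w)) @^-1` E = \bigcup_(s in setT) S s.
  apply/seteqP; split => [w FE|w [s _ [/= FE /= rs]]]; first by exists (r w).
  by rewrite /= rs.
apply: (@fin_bigcup_measurable _ (g_sigma_algebraType G)) => // s _.
apply: (@measurableI _ (g_sigma_algebraType G)); apply: sub_sigma_algebra.
  left; exists ((F ^~ s) @^-1` E); last by rewrite setTI.
  by rewrite -[X in measurable X]setTI; exact: mF.
by right; exists [set s] => //; rewrite setTI.
Qed.

Lemma joint_sigma_algebra_measurable : (forall S, measurable (r @^-1` S)) ->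
  measurable_fun setT (fun w => F (A w, B w) (r w)).
Proof.
move=> mr _ E mE; rewrite setTI.
have mAB : measurable_fun setT (fun w => (A w, B w)).
  exact: measurable_fun_pair.
have sub : <<s G >> `<=` measurable.
  apply: smallest_sub; first exact: sigma_algebra_measurable.
  by move=> _ [] [C mC <-]; [exact: mAB | rewrite setTI; exact: mr].
apply: sub; exact: joint_sigma_algebra_preimage.
Qed.

End JointSigmaAlgebra.

Lemma mutually_independent2 d (T : measurableType d) (R : realType)
    (P : probability T R) (I : finType) (G : I -> set_system T) i j :
  mutually_independent P G -> i != j -> independent2 P (G i) (G j).
Proof.
move=> indep ij E F GE GF.
pose H k := if k == i then E else F.
have HG k : k \in [set i; j]%SET -> G k (H k).
  rewrite !inE /H; case: eqVneq => [->|_ /eqP->] //.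
have := indep [set i; j]%SET H HG.
rewrite big_setU1 ?inE//= big_set1 /H eqxx eq_sym (negPf ij) => <-.
congr (P _); apply/seteqP; split => [w [Ew Fw] k|w EF] /=.
  by rewrite !inE; case: eqP.
split; first by have := EF i; rewrite /= !inE eqxx; exact.
by have := EF j; rewrite /= !inE eqxx orbT eq_sym (negPf ij); exact.
Qed.

(** * Comparison of second moments *)

Section SquareBounds.
Context d (T : measurableType d) (R : realType) (P : probability T R).
Implicit Types X Y Z : T -> R.

Lemma expectation_sqr_le X Y : measurable_fun setT X -> measurable_fun setT Y ->
  (forall w, `|X w| <= `|Y w|) ->
  ('E_P[fun w => (X w ^+ 2)%R] <= 'E_P[fun w => (Y w ^+ 2)%R])%E.
Proof.
move=> mX mY XY; rewrite unlock; apply: ge0_le_integral => //=.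
- by move=> w _; rewrite lee_fin sqr_ge0.
- by apply/measurable_EFinP; exact: measurable_funX.
- by apply/measurable_EFinP; exact: measurable_funX.
- move=> w _; rewrite lee_fin -(real_normK (num_real (X w))).
  by rewrite -(real_normK (num_real (Y w))) lerXn2r// nnegrE.
Qed.

Lemma Lfun2_le X Y : measurable_fun setT X -> Y \in Lfun P 2%:E ->
  (forall w, `|X w| <= `|Y w|) -> X \in Lfun P 2%:E.
Proof.
move=> mX Y2 XY; apply: Lfun2_lty => //.
have mY := Lfun2_measurable Y2.
have := expectation_sqr_le mX mY XY; rewrite unlock => /le_lt_trans; apply.
have := Lfun2_expectation_sqr_fin_num Y2; rewrite unlock ge0_fin_numE//.
by apply: integral_ge0 => w _; rewrite lee_fin sqr_ge0.
Qed.

Lemma expectation_sqr_triangle X Y Z : measurable_fun setT X ->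
  measurable_fun setT Y -> measurable_fun setT Z ->
  ('E_P[fun w => ((X w - Z w) ^+ 2)%R] <=
   2%:E * 'E_P[fun w => ((X w - Y w) ^+ 2)%R] +
   2%:E * 'E_P[fun w => ((Y w - Z w) ^+ 2)%R])%E.
Proof.
move=> mX mY mZ; rewrite unlock.
have mS (U V : T -> R) : measurable_fun setT U -> measurable_fun setT V ->
    measurable_fun setT (fun w : T => ((U w - V w) ^+ 2)%:E : \bar R).
  move=> mU mV; apply/measurable_EFinP.
  by apply: measurable_funX; exact: measurable_funB.
have S0 (U V : T -> R) (w : T) : setT w ->
    (0 <= ((U w - V w) ^+ 2)%:E :> \bar R)%E.
  by move=> _; rewrite lee_fin sqr_ge0.
have S20 (U V : T -> R) (w : T) : setT w ->
    (0 <= 2%:E * ((U w - V w) ^+ 2)%:E :> \bar R)%E.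
  by move=> _; rewrite mule_ge0// lee_fin sqr_ge0.
rewrite -!ge0_integralZl//; [|exact: mS|exact: S0|exact: mS|exact: S0].
rewrite -ge0_integralD//; [|exact: S20|by apply: measurable_funeM; exact: mS
  |exact: S20|by apply: measurable_funeM; exact: mS].
apply: ge0_le_integral => //.
- exact: S0.
- exact: mS.
- by apply: emeasurable_funD; apply: measurable_funeM; exact: mS.
- move=> w _; rewrite -!EFinM -EFinD lee_fin.
  (* The right side minus the left is exactly this square. *)
  have := sqr_ge0 (X w - Y w - (Y w - Z w)); nra.
Qed.

End SquareBounds.

(** * Lipschitz functions *)

Lemma klipschitz_ge0 (R : realType) (f : R -> R) (k : R) :
  (forall x y, `|f x - f y| <= k * `|x - y|) -> 0 <= k.
Proof.
by move=> lip; have := le_trans (normr_ge0 _) (lip 1 0);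
  rewrite subr0 normr1 mulr1.
Qed.

Lemma klipschitz_continuous (R : realType) (f : R -> R) (k : R) :
  (forall x y, `|f x - f y| <= k * `|x - y|) -> continuous f.
Proof.
move=> lip x; apply/cvgrPdist_lt => e e0.
have k0 := klipschitz_ge0 lip.
(* [k] may be 0, hence the radius [e / (k + 1)]. *)
have k1 : 0 < k + 1 by rewrite ltr_wpDl.
near=> y.
apply: le_lt_trans (lip x y) _.
apply: (@le_lt_trans _ _ ((k + 1) * `|x - y|)).
  by rewrite ler_wpM2r// lerDl.
rewrite -ltr_pdivlMl// mulrC; near: y.
by apply: (nbhsx_ballx x (e / (k + 1))); rewrite divr_gt0.
Unshelve. all: by end_near. Qed.

(** * Mean square error and variance of the sampled payoff *)

Section Payoff.
Context d (T : measurableType d) (R : realType) (P : probability T R) (n : nat).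
Variables (a b : {RV P >-> n.-tuple R}).
Hypothesis moment_ab : forall j : 'I_n, (0 < second_moment P a b j < +oo)%E.
Variables (f : R -> R) (Cf : R).
Hypothesis lip_f : forall x y, `|f x - f y| <= Cf * `|x - y|.

Local Notation payoff := (fun w => f (dotp (a w) (b w))).
Local Notation sigma2 := (n%:R * nu P a b + mu P a b).

Lemma measurable_lipschitz : measurable_fun setT f.
Proof.
apply: continuous_measurable_fun; exact: klipschitz_continuous lip_f.
Qed.

(** It is the expectation of the nonnegative [sampling_variance]; the square root in [c1] relies on
    it. *)
Lemma sigma2_ge0 : 0 <= sigma2.
Proof.
rewrite -lee_fin -(integral_sampling_variance moment_ab).
by apply: integral_ge0 => w _; rewrite lee_fin sampling_variance_ge0.
Qed.

(** Up to the constant [f 0], the payoff is dominated by [Cf] times the absolute value of the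
    square-integrable [dotp]. *)
Lemma Lfun2_payoff : payoff \in Lfun P 2%:E.
Proof.
have D2 := Lfun2_dotp moment_ab; have mD := Lfun2_measurable D2.
have mf := measurableT_comp measurable_lipschitz mD.
have -> : payoff = (payoff \- cst (f 0)) \+ cst (f 0).
  by apply/funext => w /=; rewrite subrK.
rewrite rpredD ?lee1n//= ?Lfun_cst// => _.
apply: (@Lfun2_le _ _ _ _ _ (Cf \o* (fun w => dotp (a w) (b w)))).
- exact: measurable_funB.
- by rewrite Lfun_scale// ler1n.
- move=> w /=; apply: le_trans (lip_f _ _) _.
  by rewrite subr0 normrM mulrC (ger0_norm (klipschitz_ge0 lip_f)).
Qed.

Section Realisation.
Variables (A B : {RV P >-> n.-tuple R}).
Hypothesis lawAB : same_law P (fun w => (A w, B w)) (fun w => (a w, b w)).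
Variables (m : nat) (r : T -> m.-tuple 'I_n).
Hypothesis rU : uniform_sample P A B r.

Local Notation payoffAB := (fun w => f (dotp (A w) (B w))).

(* The paper's [\hat P], using only the sampled indices at the positions [g]. *)
Definition subsampled_payoff p (g : 'I_p -> 'I_m) (w : T) : R :=
  f (sampled_dotp (A w) (B w) [tuple tnth (r w) (g k) | k < p]).

(** The constants come from [(a, b)] while the estimators use copies [(A, B)]; this is the bridge
    between them. *)
Lemma same_law_ge0_expectation (h : n.-tuple R * n.-tuple R -> R) :
  measurable_fun setT h -> (forall u, 0 <= h u) ->
  ('E_P[fun w => h (A w, B w)] = 'E_P[fun w => h (a w, b w)])%E.
Proof.
move=> mh h0; rewrite unlock.
apply: (same_law_ge0_integral (h := EFin \o h)) => //.
- exact: measurable_fun_pair.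
- exact: measurable_fun_pair.
- exact/measurable_EFinP.
Qed.

Lemma measurable_dotpAB : measurable_fun setT (fun w => dotp (A w) (B w)).
Proof.
exact: (measurableT_comp (@measurable_dotp R n) (measurable_pair_ab A B)).
Qed.

Lemma measurable_payoffAB : measurable_fun setT payoffAB.
Proof. exact: (measurableT_comp measurable_lipschitz measurable_dotpAB). Qed.

Lemma measurable_subsampled_dotp p (g : 'I_p -> 'I_m) :
  measurable_fun setT (fun w =>
    sampled_dotp (A w) (B w) [tuple tnth (r w) (g k) | k < p]).
Proof.
have [mr _ _ _] := rU.
pose F (uv : n.-tuple R * n.-tuple R) (s : m.-tuple 'I_n) :=
  sampled_dotp uv.1 uv.2 [tuple tnth s (g k) | k < p].
apply: (joint_sigma_algebra_measurable A B (F := F)) => // s.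
exact: measurable_sampled_dotp.
Qed.

Lemma measurable_subsampled_payoff p (g : 'I_p -> 'I_m) :
  measurable_fun setT (subsampled_payoff g).
Proof.
exact: (measurableT_comp measurable_lipschitz (measurable_subsampled_dotp g)).
Qed.

Lemma Lfun2_payoffAB : payoffAB \in Lfun P 2%:E.
Proof.
apply: Lfun2_lty; first exact: measurable_payoffAB.
have mh : measurable_fun setT
    (fun uv : n.-tuple R * n.-tuple R => f (dotp uv.1 uv.2) ^+ 2).
  apply: measurable_funX.
  exact: (measurableT_comp measurable_lipschitz (@measurable_dotp R n)).
have := same_law_ge0_expectation mh (fun _ => sqr_ge0 _); rewrite unlock => ->.
have := Lfun2_expectation_sqr_fin_num Lfun2_payoff.
rewrite unlock ge0_fin_numE//.
by apply: integral_ge0 => w _; rewrite lee_fin sqr_ge0.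
Qed.

Lemma expectation_sqr_payoff_dev c :
  ('E_P[fun w => ((f (dotp (A w) (B w)) - c) ^+ 2)%R] =
   'E_P[fun w => ((f (dotp (a w) (b w)) - c) ^+ 2)%R])%E.
Proof.
apply: (same_law_ge0_expectation
  (h := fun uv => (f (dotp uv.1 uv.2) - c) ^+ 2)) => [|u].
  apply: measurable_funX; apply: measurable_funB => //.
  exact: (measurableT_comp measurable_lipschitz (@measurable_dotp R n)).
exact: sqr_ge0.
Qed.

(** The Lipschitz bound reduces the error to [Cf] times the deviation of the sampled dot product,
    whose second moment is exactly [sigma2 / p]. *)
Lemma subsampled_payoff_sqr_error p (g : 'I_p -> 'I_m) :
  injective g -> (0 < p)%N ->
  ('E_P[fun w => ((subsampled_payoff g w - f (dotp (A w) (B w))) ^+ 2)%R]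
   <= (Cf ^+ 2 * sigma2 / p%:R)%:E)%E.
Proof.
move=> ginj p0.
pose X w := Cf * (sampled_dotp (A w) (B w) [tuple tnth (r w) (g k) | k < p]
                  - dotp (A w) (B w)).
have mdev := measurable_funB (measurable_subsampled_dotp g) measurable_dotpAB.
apply: le_trans (expectation_sqr_le P (Y := X) _ _ _) _.
- apply: measurable_funB; first exact: measurable_subsampled_payoff.
  exact: measurable_payoffAB.
- exact: measurable_funM.
- move=> w; rewrite normrM (ger0_norm (klipschitz_ge0 lip_f)).
  exact: lip_f.
have mA : measurable_fun setT A by [].
have mB : measurable_fun setT B by [].
have dev := uniform_sample_sqr_dev mA mB rU ginj p0.
have var : (\int[P]_w (sampling_variance (A w) (B w))%:E = sigma2%:E)%E.
  rewrite -(integral_sampling_variance moment_ab).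
  have mh := @measurable_sampling_variance R n.
  have := same_law_ge0_expectation mh
    (fun u => sampling_variance_ge0 u.1 u.2).
  by rewrite unlock.
rewrite unlock.
under eq_integral do rewrite exprMn EFinM.
rewrite ge0_integralZl//; last 3 first.
- by apply/measurable_EFinP; exact: measurable_funX.
- by move=> w _; rewrite lee_fin sqr_ge0.
- by rewrite lee_fin sqr_ge0.
by rewrite dev var -!EFinM lee_fin [p%:R^-1 * _]mulrC mulrA.
Qed.

Lemma Lfun2_subsampled_payoff p (g : 'I_p -> 'I_m) :
  injective g -> (0 < p)%N -> subsampled_payoff g \in Lfun P 2%:E.
Proof.
move=> ginj p0.
have -> : subsampled_payoff g =
    (subsampled_payoff g \- payoffAB) \+ payoffAB.
  by apply/funext => w /=; rewrite subrK.
rewrite rpredD ?lee1n//= ?Lfun2_payoffAB// => _.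
apply: Lfun2_lty.
  apply: measurable_funB; first exact: measurable_subsampled_payoff.
  exact: measurable_payoffAB.
have := subsampled_payoff_sqr_error ginj p0.
by rewrite unlock => /le_lt_trans; apply; rewrite ltry.
Qed.

Lemma variance_subsampled_payoff_le p (g : 'I_p -> 'I_m) :
  injective g -> (0 < p)%N ->
  ('V_P[subsampled_payoff g] <=
   (2 * Cf ^+ 2 * sigma2 / p%:R + 2 * fine 'V_P[payoff])%:E)%E.
Proof.
(* Centring at the mean of the payoff turns the second term of the triangle inequality into
   [V[P]]. *)
move=> ginj p0; set c := fine 'E_P[payoff]%E.
apply: le_trans (variance_le_sqr c (Lfun2_subsampled_payoff ginj p0)) _.
have mc : measurable_fun setT (fun _ : T => c) by [].
apply: le_trans (expectation_sqr_triangle P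
  (measurable_subsampled_payoff g) measurable_payoffAB mc) _.
rewrite expectation_sqr_payoff_dev [leRHS]EFinD; apply: leeD.
  rewrite -2!mulrA EFinM lee_pmul2l// mulrA.
  exact: subsampled_payoff_sqr_error.
rewrite EFinM fineK ?variance_fin_num ?Lfun2_payoff//.
by rewrite /variance covariance.unlock; exact: lexx.
Qed.

(** Both estimators use the same vectors, so they are compared with one payoff, which cancels;
    shared positions do no harm, as the two errors are bounded separately. *)
Lemma variance_subsampled_payoffB_le p (g : 'I_p -> 'I_m)
    p' (g' : 'I_p' -> 'I_m) :
  injective g -> (0 < p)%N -> injective g' -> (0 < p')%N ->
  ('V_P[(subsampled_payoff g \- subsampled_payoff g')%R] <=
   (2 * Cf ^+ 2 * sigma2 * (p%:R^-1 + p'%:R^-1))%:E)%E.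
Proof.
move=> ginj p0 ginj' p0'.
have g2 := Lfun2_subsampled_payoff ginj p0.
have g2' := Lfun2_subsampled_payoff ginj' p0'.
apply: le_trans (variance_le_sqr 0 (Lfun2B g2 g2')) _.
have -> : (fun w =>
      ((subsampled_payoff g \- subsampled_payoff g') w - 0) ^+ 2) =
    (fun w => (subsampled_payoff g w - subsampled_payoff g' w) ^+ 2).
  by apply/funext => w; rewrite subr0.
apply: le_trans (expectation_sqr_triangle P
  (measurable_subsampled_payoff g) measurable_payoffAB
  (measurable_subsampled_payoff g')) _.
rewrite mulrDr [leRHS]EFinD; apply: leeD.
  rewrite -2!mulrA EFinM lee_pmul2l// mulrA; exact: subsampled_payoff_sqr_error.
rewrite -2!mulrA EFinM lee_pmul2l// mulrA.
under [X in expectation _ X]eq_fun do rewrite -sqrrN opprB.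
exact: subsampled_payoff_sqr_error.
Qed.

End Realisation.
End Payoff.

(** * Means over independent realisations and the final bounds *)

(** The events of [Z k] lie in the sigma-algebra of the [k]-th realisation, so mutual independence
    makes distinct [Z k] uncorrelated. *)
Lemma iid_mean_variance_le d (T : measurableType d) (R : realType)
    (P : probability T R) n (a b : {RV P >-> n.-tuple R}) m N
    (A B : 'I_N -> {RV P >-> n.-tuple R}) (r : 'I_N -> T -> m.-tuple 'I_n)
    (F : n.-tuple R * n.-tuple R -> m.-tuple 'I_n -> R) (v : \bar R) :
  (0 < N)%N -> iid_realisations a b A B r ->
  (forall s, measurable_fun setT (F ^~ s)) ->
  let Z k w := F (A k w, B k w) (r k w) in
  (forall k, Z k \in Lfun P 2%:E) -> (forall k, 'V_P[Z k] <= v)%E ->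
  ('V_P[fun w => (N%:R^-1 * \sum_(k < N) Z k w)%R] <= N%:R^-1%:E * v)%E.
Proof.
move=> N0 [_ _ indep] mF Z Z2 Zv.
apply: (variance_mean_le N0 Z2 _ Zv) => k l kl.
apply: independent2_covariance0 => // E E' [C mC <-] [C' mC' <-].
rewrite !setTI; apply: (mutually_independent2 indep kl);
  exact: joint_sigma_algebra_preimage.
Qed.

Lemma tnth_id_mktuple (T : Type) m (s : m.-tuple T) :
  [tuple tnth s (id k) | k < m] = s.
Proof. by apply: eq_from_tnth => k; rewrite tnth_mktuple. Qed.

(** Adding one undoes the 0-based shift and leaves [j.+1 * M], where [M > 0] cancels. The coarse
    average thus runs over distinct positions. *)
Lemma coarse_index_inj M l (M_gt0 : (0 < M)%N) :
  injective (@coarse_index M l M_gt0).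
Proof.
move=> i j /(congr1 val)/= /(congr1 succn).
rewrite !prednK ?muln_gt0// => /eqP; rewrite eqn_pmul2r// => /eqP[ij].
exact: val_inj.
Qed.

Theorem corollary2p4 (R : realType) (d : measure_display)
    (T : measurableType d) (Pr : probability T R) (n : nat)
    (a b : {RV Pr >-> n.-tuple R})
    (moment_ab : forall j : 'I_n, (0 < second_moment Pr a b j < +oo)%E)
    (f : R -> R) (Cf : R) (lip_f : Cf.-lipschitz f)
    (M : nat) (M_gt0 : (0 < M)%N) :
  let m := mu Pr a b in
  let v := nu Pr a b in
  let payoff := fun w : T => f (dotp (a w) (b w)) in
  let c1 := Cf * Num.sqrt (n%:R * v + m) in
  let c2 := 2 * Cf ^+ 2 * (M%:R + 1) * (n%:R * v + m)
            + 2 * fine 'V_Pr[payoff]%E in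
  let c3 := 1 + M%:R^-1 : R in
  [/\ forall (l : nat) (r : T -> (M ^ l).-tuple 'I_n),
        uniform_sample Pr a b r ->
        (`| 'E_Pr[fun w => (f (sampled_dotp (a w) (b w) (r w)) - payoff w)%R] |
         <= (c1 * M%:R `^ (- (l%:R / 2)))%:E)%E,
      (forall (l N : nat) (A B : 'I_N -> {RV Pr >-> n.-tuple R})
          (r : 'I_N -> T -> (M ^ l).-tuple 'I_n),
        (0 < N)%N -> iid_realisations a b A B r ->
        ('V_Pr[level_estimator f M_gt0 A B r]
         <= (c2 * N%:R^-1 * M%:R ^- l)%:E)%E) /\
      (forall (L N : nat) (A B : 'I_N -> {RV Pr >-> n.-tuple R})
          (r : 'I_N -> T -> (M ^ L).-tuple 'I_n),
        (0 < N)%N -> iid_realisations a b A B r ->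
        ('V_Pr[mc_estimator f A B r] <= (c2 * N%:R^-1)%:E)%E)
    & (forall l N : nat, (0 < N)%N ->
        (level_cost M N l)%:R <= c3 * N%:R * M%:R ^+ l) /\
      (forall L N : nat, (0 < N)%N ->
        (mc_cost M N L)%:R <= c3 * N%:R * M%:R ^+ L)].
Proof.
move=> m v payoff c1 c2 c3.
have lip x y : `|f x - f y| <= Cf * `|x - y| by exact: (lip_f (x, y)).
have Cf0 := klipschitz_ge0 lip.
have mf := measurable_lipschitz lip.
have sigma0 : 0 <= n%:R * v + m := sigma2_ge0 moment_ab.
have V0 : 0 <= fine 'V_Pr[payoff]%E by rewrite fine_ge0// variance_ge0.
have M0 : 0 < M%:R :> R by rewrite ltr0n.
have Ml0 l : (0 < M ^ l)%N by rewrite expn_gt0 M_gt0.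
(* The full sample is the subsample along the identity. *)
have id_inj k : injective (@id 'I_k) by [].
have mP k (s : k.-tuple 'I_n) : measurable_fun setT
    (fun uv : n.-tuple R * n.-tuple R => f (sampled_dotp uv.1 uv.2 s)).
  exact: (measurableT_comp mf (@measurable_sampled_dotp R n k s)).
split.
- move=> l r rU.
  (* The bias concerns the model pair, taken as a realisation of itself. *)
  have law_ab : same_law Pr (fun w => (a w, b w)) (fun w => (a w, b w)) by [].
  have err := subsampled_payoff_sqr_error moment_ab lip law_ab rU
    (id_inj _) (Ml0 l).
  set Z := fun w => _ - _.
  have ZE : Z = subsampled_payoff f a b r (@id 'I_(M ^ l)) \- payoff.
    by apply/funext => w; rewrite /Z /= /subsampled_payoff tnth_id_mktuple.
  have Z2 : Z \in Lfun Pr 2%:E.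
    rewrite ZE; apply: Lfun2B (Lfun2_payoff moment_ab lip).
    exact: (Lfun2_subsampled_payoff moment_ab lip law_ab rU).
  have := le_trans (sqr_expectation_le Z2) _.
  rewrite -(fineK (Lfun2_expectation_fin_num Z2)).
  move=> /(_ (Cf ^+ 2 * (n%:R * v + m) / (M ^ l)%:R)%:E) ZZ.
  (* Both sides are nonnegative, so squares are compared, where [(E Z)^2 <= E Z^2] applies. *)
  rewrite lee_fin -ler_sqr ?nnegrE ?mulr_ge0 ?sqrtr_ge0 ?powR_ge0//.
  rewrite real_normK ?num_real// -lee_fin.
  (* Squaring turns the real exponent [-l/2] into the integer power [M^-l]. *)
  have -> : (c1 * M%:R `^ (- (l%:R / 2))) ^+ 2 =
      Cf ^+ 2 * (n%:R * v + m) / (M ^ l)%:R.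
    rewrite !exprMn sqr_sqrtr//; congr (_ * _).
    rewrite -powR_mulrn ?powR_ge0// -powRrM mulNr divfK ?pnatr_eq0//.
    by rewrite powRN powR_mulrn ?ler0n// natrX.
  by rewrite EFin_expe; apply: ZZ; rewrite ZE.
(* A bound uniform in the sample size, from [1/k <= 1 <= M + 1]. *)
- have c2_ge k : (0 < k)%N ->
      2 * Cf ^+ 2 * (n%:R * v + m) / k%:R + 2 * fine 'V_Pr[payoff]%E <= c2.
    move=> k0; rewrite lerD2r; set y := 2 * _ * _.
    have y0 : 0 <= y by rewrite !mulr_ge0// sqr_ge0.
    rewrite [leRHS]mulrAC -/y; apply: ler_wpM2l => //.
    rewrite (le_trans (y := 1)) ?invf_le1 ?ltr0n ?ler1n//.
    by rewrite lerDr ltW.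
  (* Any sample size is allowed, so as to serve both the standard estimator and level 0. *)
  have mc_le k N (A B : 'I_N -> {RV Pr >-> n.-tuple R})
      (r : 'I_N -> T -> k.-tuple 'I_n) : (0 < k)%N -> (0 < N)%N ->
      iid_realisations a b A B r ->
      ('V_Pr[mc_estimator f A B r] <= (c2 * N%:R^-1)%:E)%E.
    move=> k0 N0 iid; have [law_AB rU _] := iid.
    have PE j : (fun w => f (sampled_dotp (A j w) (B j w) (r j w))) =
        subsampled_payoff f (A j) (B j) (r j) id.
      by apply/funext => w; rewrite /subsampled_payoff tnth_id_mktuple.
    rewrite mulrC EFinM.
    apply: (iid_mean_variance_le N0 iid
      (F := fun uv s => f (sampled_dotp uv.1 uv.2 s))) => [|j|j].
    + exact: mP.
    + rewrite /= PE.
      exact: (Lfun2_subsampled_payoff moment_ab lip (law_AB j) (rU j)).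
    + rewrite /= PE.
      apply: le_trans (variance_subsampled_payoff_le moment_ab lip (law_AB j)
        (rU j) (id_inj _) k0) _.
      by rewrite lee_fin c2_ge.
  split=> [[|l] N A B r N0 iid|L N A B r N0 iid]; last exact: mc_le.
    (* Level 0 has no coarse term, so its estimator is the standard one, and [M^-0 = 1]. *)
    by rewrite expr0 invr1 mulr1; exact: mc_le.
  have [law_AB rU _] := iid.
  have PE j : (fun w => level_term f M_gt0 (A j w) (B j w) (r j w)) =
      subsampled_payoff f (A j) (B j) (r j) id \-
      subsampled_payoff f (A j) (B j) (r j) (coarse_index M_gt0 (l := l)).
    by apply/funext => w; rewrite /= /subsampled_payoff tnth_id_mktuple.
  rewrite [_ * N%:R^-1]mulrC -mulrA EFinM.
  apply: (iid_mean_variance_le N0 iid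
    (F := fun uv s => level_term f M_gt0 uv.1 uv.2 s)) => [s|j|j].
  + by apply: measurable_funB; exact: mP.
  + rewrite PE; apply: Lfun2B.
      exact: (Lfun2_subsampled_payoff moment_ab lip (law_AB j) (rU j)).
    apply: (Lfun2_subsampled_payoff moment_ab lip (law_AB j) (rU j)) => //.
    exact: coarse_index_inj.
  + rewrite PE.
    apply: le_trans (variance_subsampled_payoffB_le moment_ab lip (law_AB j)
      (rU j) (id_inj _) (Ml0 _) (@coarse_index_inj _ _ _) (Ml0 _)) _.
    (* As [M^-(l+1) + M^-l = (M + 1) M^-(l+1)], the first part of [c2] matches exactly; the part [2
       V[P]] is bounded below by 0. *)
    rewrite lee_fin /c2 [leRHS]mulrDl -[leLHS]addr0.
    apply: lerD; last by rewrite !mulr_ge0// invr_ge0 exprn_ge0 ?ltW.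
    rewrite !natrX !(exprS M%:R l) -/v -/m le_eqVlt; apply/orP; left; apply/eqP.
    by field; rewrite ?expf_neq0 ?gt_eqF.
- split=> [[|l] N N0|L N N0].
  + rewrite expr0 mulr1 -[leLHS]mul1r; apply: ler_wpM2r => //.
    by rewrite lerDl invr_ge0 ltW.
  (* An equality: [N (M^(l+1) + M^l) = (1 + M^-1) N M^(l+1)]. *)
  + rewrite /level_cost natrM natrD !natrX le_eqVlt; apply/orP; left.
    by apply/eqP; rewrite /c3 exprS; field; rewrite gt_eqF.
  + rewrite /mc_cost natrM natrX; apply: ler_wpM2r; first exact/exprn_ge0/ltW.
    rewrite -[leLHS]mul1r; apply: ler_wpM2r => //.
    by rewrite lerDl invr_ge0 ltW.
Qed.
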